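(* For each $s\in\{1,5,9,13\}$, there is a binary singly even self-dual $[82,41,14]$ code whose shadow has minimum weight $s$.
   Context: All codes are binary: a code of length $n$ is a subspace of $\mathbb{F}_2^n$, and $[n,k,d]$ denotes length $n$, dimension $k$, minimum weight $d$. A code $C$ is self-dual if $C=C^\perp$ with respect to the standard inner product. A self-dual code is singly even if it contains a codeword of weight $\equiv 2 \pmod 4$. For a singly even self-dual code $C$, let $C_0$ be the subcode of codewords of weight $\equiv 0 \pmod 4$; the shadow of $C$ is $S=C_0^\perp\setminus C$, and its minimum weight is the smallest weight of a vector in $S$. *)

(* Defs.v *)
(* Mathematical Components world *)
From HB Require Import structures.
From mathcomp Require Import all_boot all_order all_algebra.

Set Implicit Arguments.
Unset Strict Implicit.
Unset Printing Implicit Defensive.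

Import GRing.Theory.
Local Open Scope ring_scope.

Section Codes.

Variable n : nat.
Implicit Types (u v : 'rV['F_2]_n) (A : {set 'rV['F_2]_n})
  (C : {vspace 'rV['F_2]_n}).

Definition wt v : nat := #|[set i | v 0 i != 0]|.

Definition dotp u v : 'F_2 := \sum_(i < n) u 0 i * v 0 i.

Definition codewords C : {set 'rV['F_2]_n} := [set v | v \in C].

(* The dual is taken of an arbitrary set of vectors, so that it applies to the
   doubly even subset of a code without first proving that subset linear. *)
Definition dual A : {set 'rV['F_2]_n} :=
  [set u | [forall v in A, dotp u v == 0]].

Definition has_min_weight A (d : nat) : Prop :=
  (exists2 v, v \in A & wt v = d) /\ (forall v, v \in A -> (d <= wt v)%N).

(* The minimum weight of a code is over its nonzero codewords. *)
Definition code_params C (k d : nat) : Prop :=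
  \dim C = k /\ has_min_weight (codewords C :\ 0) d.

Definition self_dual C : Prop := codewords C = dual (codewords C).

Definition singly_even C : Prop :=
  exists2 v, v \in C & (wt v = 2 %[mod 4])%N.

Definition doubly_even_part C : {set 'rV['F_2]_n} :=
  [set v in codewords C | (4 %| wt v)%N].

(* The zero vector lies in C, so no nonzero condition is needed when taking
   the minimum weight of the shadow. *)
Definition shadow C : {set 'rV['F_2]_n} :=
  dual (doubly_even_part C) :\: codewords C.

End Codes.

(* Main.v *)
(* Each code is generated by [I | A] with A orthogonal of order 41, hence is
   self-dual and both halves of the coordinates are information sets. A codeword of
   weight at most 12 is then the sum of at most 6 rows of [I | A] or of at most 5
   rows of [A^T | I], and enumerating these sums proves the minimum weight; A
   commutes with a permutation of order 5, which cuts the enumeration by about that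
   factor. The shadow is the coset v + C of a vector v of weight s, which is
   recognised on the generators, and its weights are congruent to s modulo 4, so
   that a much shorter enumeration of the same kind proves its minimum weight. *)

Require Import Defs.
From HB Require Import structures.
From Stdlib Require Import BinPos.
From mathcomp Require Import all_boot all_order all_algebra zify.

Set Implicit Arguments.
Unset Strict Implicit.
Unset Printing Implicit Defensive.

Import GRing.Theory.
Local Open Scope ring_scope.

(** * Weights, overlaps and inner products over F_2 *)

Section Vectors.
Variable n : nat.
Implicit Types u v w : 'rV['F_2]_n.

Lemma F2P (x : 'F_2) : (x == 0) || (x == 1).
Proof. by case: x => [[|[|]]]. Qed.

Lemma natF2_eq0 m : (m%:R == 0 :> 'F_2) = ~~ odd m.
Proof. by rewrite -(dvdn_pcharf (pchar_Fp (isT : prime 2))) dvdn2. Qed.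

Lemma addF2_mx m (M : 'M['F_2]_(m, n)) : M + M = 0.
Proof.
apply/matrixP => i j; rewrite !mxE.
by case/orP: (F2P (M i j)) => /eqP ->; apply/eqP.
Qed.

Definition overlap u v : nat := #|[set i | (u 0 i != 0) && (v 0 i != 0)]|.

Lemma wtE u : wt u = (\sum_i (u 0%R i != 0%R))%N.
Proof. by rewrite /wt cardsE -sum1_card big_mkcond. Qed.

Lemma overlapE u v : overlap u v = (\sum_i ((u 0%R i != 0%R) && (v 0%R i != 0%R)))%N.
Proof. by rewrite /overlap cardsE -sum1_card big_mkcond. Qed.

Lemma overlapC u v : overlap u v = overlap v u.
Proof. by rewrite !overlapE; apply: eq_bigr => i _; rewrite andbC. Qed.

Lemma overlapvv u : overlap u u = wt u.
Proof. by rewrite overlapE wtE; apply: eq_bigr => i _; rewrite andbb. Qed.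

Lemma overlap_delta i u :
  overlap (delta_mx 0 i) u = (u 0 i != 0).
Proof.
rewrite overlapE (bigD1 i) //= big1 => [|j ji]; first by rewrite mxE !eqxx addn0.
by rewrite mxE (negPf ji) andbF eqxx.
Qed.

Lemma wt_delta i : wt (delta_mx 0 i : 'rV['F_2]_n) = 1%N.
Proof. by rewrite -overlapvv overlap_delta mxE !eqxx. Qed.

Lemma wt_add u v : (wt (u + v) + (overlap u v).*2 = wt u + wt v)%N.
Proof.
rewrite !wtE overlapE -muln2 big_distrl -!big_split /=; apply: eq_bigr => i _.
rewrite mxE; case/orP: (F2P (u 0 i)) => /eqP ->;
  by case/orP: (F2P (v 0 i)) => /eqP ->.
Qed.

Lemma dotpE u v : dotp u v = (overlap u v)%:R.
Proof.
rewrite /dotp overlapE natr_sum; apply: eq_bigr => i _.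
case/orP: (F2P (u 0 i)) => /eqP ->; case/orP: (F2P (v 0 i)) => /eqP ->;
  by apply/eqP.
Qed.

Lemma dotp_eq0 u v : (dotp u v == 0) = ~~ odd (overlap u v).
Proof. by rewrite dotpE natF2_eq0. Qed.

Lemma dotp_eq1 u v : (dotp u v == 1) = odd (overlap u v).
Proof.
rewrite -[odd _]negbK -dotp_eq0.
by case/orP: (F2P (dotp u v)) => /eqP ->.
Qed.

Lemma dotpC u v : dotp u v = dotp v u.
Proof. by rewrite !dotpE overlapC. Qed.

Lemma dotpDr u v w : dotp u (v + w) = dotp u v + dotp u w.
Proof.
by rewrite /dotp -big_split; apply: eq_bigr => i _; rewrite mxE mulrDr.
Qed.

Lemma dotpDl u v w : dotp (u + v) w = dotp u w + dotp v w.
Proof. by rewrite dotpC dotpDr !(dotpC w). Qed.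

Lemma odd_overlapDl u v w :
  odd (overlap (u + v) w) = odd (overlap u w) (+) odd (overlap v w).
Proof.
apply: negb_inj; rewrite -dotp_eq0 dotpDl !dotpE -natrD natF2_eq0.
by rewrite oddD.
Qed.

Lemma dotp_mulmx u v : dotp u v = (u *m v^T) 0 0.
Proof. by rewrite mxE; apply: eq_bigr => i _; rewrite mxE. Qed.

Lemma dotp_eq0_all u : (forall v, dotp u v = 0) -> u = 0.
Proof.
move=> u0; apply/rowP => i; rewrite mxE -(u0 (delta_mx 0 i)) /dotp.
rewrite (bigD1 i) //= big1 => [|j ji]; first by rewrite mxE !eqxx mulr1 addr0.
by rewrite mxE (negPf ji) andbF mulr0.
Qed.

Lemma addF2_eq0 u v : (u + v == 0) = (u == v).
Proof.
apply/eqP/eqP => [uv|->]; last exact: addF2_mx.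
by rewrite -[u]addr0 -(addF2_mx v) addrA uv add0r.
Qed.

(* On a singly even self-dual code this condition says that [v] is orthogonal
   to exactly the doubly even codewords, i.e. that [v] lies in the shadow; it only
   has to be tested on generators. *)
Definition char_form v u := (4 %| wt u + (overlap u v).*2)%N.

Lemma char_formD v u w : dotp u w = 0 ->
  char_form v u -> char_form v w -> char_form v (u + w).
Proof.
move=> /eqP; rewrite dotp_eq0 /char_form => euw qu qw.
have := wt_add u w; have := odd_overlapDl u w v; lia.
Qed.

Lemma char_form0 v : char_form v 0.
Proof.
by rewrite /char_form wtE overlapE !big1 // => i _; rewrite mxE eqxx.
Qed.

Lemma wt_char_form v u : char_form v u -> (wt (v + u) = wt v %[mod 4])%N.
Proof. by rewrite /char_form => qu; have := wt_add v u; rewrite overlapC; lia. Qed.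

End Vectors.

Section Halves.
Variable k : nat.
Implicit Types u w : 'rV['F_2]_k.

Lemma wt_row_mx u w : wt (row_mx u w) = (wt u + wt w)%N.
Proof.
rewrite !wtE big_split_ord; congr addn; apply: eq_bigr => i _.
  by rewrite row_mxEl.
by rewrite row_mxEr.
Qed.

Lemma overlap_row_mx u w u' w' :
  overlap (row_mx u w) (row_mx u' w') = (overlap u u' + overlap w w')%N.
Proof.
rewrite !overlapE big_split_ord; congr addn; apply: eq_bigr => i _.
  by rewrite !row_mxEl.
by rewrite !row_mxEr.
Qed.

End Halves.

(** * Self-duality and shadow of the code generated by [I | A] *)

Section SystematicCode.
Variables (k : nat) (A : 'M['F_2]_k).
Hypothesis AAt : A *m A^T = 1%:M.

Definition encode (m : 'rV['F_2]_k) : 'rV['F_2]_(k + k) := m *m row_mx 1%:M A.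
Definition code : {vspace 'rV['F_2]_(k + k)} :=
  limg (linfun (mulmxr (row_mx 1%:M A))).

Lemma encodeE m : encode m = row_mx m (m *m A).
Proof. by rewrite /encode mul_mx_row mulmx1. Qed.

Lemma codeP u : reflect (exists m, u = encode m) (u \in code).
Proof.
apply: (iffP idP) => [/memv_imgP[m _ ->]|[m ->]].
  by exists m; rewrite lfunE.
by have := memv_img (linfun (mulmxr (row_mx 1%:M A))) (memvf m); rewrite lfunE.
Qed.

Lemma mem_code u : (u \in code) = (rsubmx u == lsubmx u *m A).
Proof.
apply/codeP/eqP => [[m ->]|e]; first by rewrite encodeE row_mxKl row_mxKr.
by exists (lsubmx u); rewrite encodeE -e hsubmxK.
Qed.

Lemma dim_code : \dim code = k.
Proof.
rewrite limg_dim_eq; first by rewrite dimvf /dim /= mul1n.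
apply/eqP; rewrite capfv; apply/lker0P => m m'; rewrite !lfunE /=.
by rewrite -!/(encode _) !encodeE => /eq_row_mx[].
Qed.

Lemma dotp_encode u m : dotp u (encode m) = dotp (lsubmx u + rsubmx u *m A^T) m.
Proof.
rewrite !dotp_mulmx encodeE tr_row_mx -[in LHS](hsubmxK u) mul_row_col.
by rewrite trmx_mul mulmxA mulmxDl.
Qed.

(** By [dotp_encode], orthogonality to the code means that the left half is the right half times
    [A^T]. As [A^T] is the inverse of [A], this is the equation defining the code. *)
Lemma mem_codeP u : (u \in code) <-> (forall v, v \in code -> dotp u v = 0).
Proof.
split=> [/codeP[m ->] v /codeP[m' ->]|uC].
  rewrite dotp_encode encodeE row_mxKl row_mxKr -mulmxA AAt mulmx1 addF2_mx.
  by rewrite /dotp big1 // => i _; rewrite mxE mul0r.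
have /eqP : lsubmx u + rsubmx u *m A^T = 0.
  by apply: dotp_eq0_all => m; rewrite -dotp_encode uC //; apply/codeP; exists m.
rewrite addF2_eq0 mem_code => /eqP ->.
by rewrite -mulmxA (mulmx1C AAt) mulmx1.
Qed.

Lemma self_dual_code : self_dual code.
Proof.
apply/setP => u; rewrite !inE; apply/idP/forall_inP => [uC v|uC].
  by rewrite inE => vC; apply/eqP/(mem_codeP u).1.
by apply/mem_codeP => v vC; apply/eqP/uC; rewrite inE.
Qed.

Lemma even_wt_code u : u \in code -> ~~ odd (wt u).
Proof. by move=> uC; rewrite -overlapvv -dotp_eq0 (mem_codeP u).1. Qed.

Variable v : 'rV['F_2]_(k + k).
Hypothesis char_v : forall i, char_form v (encode (delta_mx 0 i)).

Lemma char_form_code u : u \in code -> char_form v u.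
Proof.
case/codeP=> m ->; rewrite (row_sum_delta m) /encode mulmx_suml.
pose F i := (m 0 i *: delta_mx 0 i : 'rV_k) *m row_mx 1%:M A.
rewrite (eq_bigr F) //.
(* Membership is carried along because [char_formD] needs the partial sum to be orthogonal to the
   next generator. *)
suff sumQ r : \sum_(i <- r) F i \in code /\ char_form v (\sum_(i <- r) F i).
  by case: (sumQ (index_enum 'I_k)).
elim: r => [|i r [rC rQ]]; first by rewrite big_nil mem0v char_form0.
rewrite big_cons {1 3}/F; case/orP: (F2P (m 0 i)) => /eqP ->.
  by rewrite scale0r mul0mx add0r.
rewrite scale1r -/(encode _); have iC : encode (delta_mx 0 i) \in code.
  by apply/codeP; exists (delta_mx 0 i).
by split; [exact: memvD | apply: char_formD => //; exact: (mem_codeP _).1].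
Qed.

Hypothesis code_singly_even : singly_even code.

(** The doubly even part is the kernel of the inner product with [v] and has index 2 in the code. A
    vector [u] orthogonal to it but not to the whole code has the same inner products with codewords
    as [v], so [v + u] is orthogonal to the code and lies in it by self-duality. *)
Lemma mem_shadow u : (u \in shadow code) = (v + u \in code).
Proof.
have [c cC c2] := code_singly_even.
have even4 w : w \in code -> (4 %| wt w)%N = (dotp v w == 0).
  move=> wC; have := char_form_code wC; rewrite /char_form dotp_eq0 overlapC.
  by have := even_wt_code wC; lia.
have vc : dotp v c = 1.
  have : ~~ (dotp v c == 0) by rewrite -even4 //; move: c2; lia.
  by case/orP: (F2P (dotp v c)) => /eqP ->.
have vNC : v \notin code by apply/negP => /(mem_codeP v).1/(_ c cC); rewrite vc.
rewrite !inE; apply/andP/idP => [[uNC /forall_inP u0]|vuC].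
  have {}u0 w : w \in code -> dotp v w = 0 -> dotp u w = 0.
    by move=> wC vw; apply/eqP/u0; rewrite !inE wC even4 // vw eqxx.
  have uc : dotp u c = 1.
    case/orP: (F2P (dotp u c)) => /eqP // uc0; case/negP: uNC.
    apply/mem_codeP => w wC; case/orP: (F2P (dotp v w)) => /eqP vw.
      exact: u0.
    have := u0 (w + c) (memvD wC cC); rewrite !dotpDr vw vc uc0 addr0.
    by apply; apply/eqP.
  apply/mem_codeP => w wC; rewrite dotpDl.
  case/orP: (F2P (dotp v w)) => /eqP vw; first by rewrite vw u0 ?addr0.
  (* Neither [w] nor [c] is orthogonal to [v], so [w + c] is doubly even and thus orthogonal to
     [u]. *)
  rewrite vw addrC -uc -dotpDr; apply: u0; first exact: memvD.
  by rewrite dotpDr vw vc; apply/eqP.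
split; first by apply: contra vNC => uC; rewrite -(rpredDr _ uC).
apply/forall_inP => w; rewrite !inE => /andP[wC]; rewrite even4 // => /eqP vw.
by have := (mem_codeP _).1 vuC w wC; rewrite dotpDl vw add0r => ->.
Qed.

Lemma wt_shadow u : u \in shadow code -> (wt u = wt v %[mod 4])%N.
Proof.
rewrite mem_shadow => /char_form_code/wt_char_form.
by rewrite addrA addF2_mx add0r.
Qed.

End SystematicCode.

(** * Computation with vectors encoded as binary numbers *)

Section BitVectors.

(* A vector of [F_2^k] is encoded, low bit first, by the binary digits below the
   leading one of a positive number. *)
Fixpoint bits (p : positive) : bitseq :=
  match p with
  | xH => [::]
  | xO p' => false :: bits p'
  | xI p' => true :: bits p'
  end.

Fixpoint pos_xor (p q : positive) : positive :=
  match p, q with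
  | xO p', xO q' | xI p', xI q' => xO (pos_xor p' q')
  | xO p', xI q' | xI p', xO q' => xI (pos_xor p' q')
  | _, _ => p
  end.

Fixpoint pos_overlap (p q : positive) : nat :=
  match p, q with
  | xI p', xI q' => (pos_overlap p' q').+1
  | xO p', xO q' | xO p', xI q' | xI p', xO q' => pos_overlap p' q'
  | _, _ => 0%N
  end.

(* The comparison stops at the first [d.+1] differences, which is what makes the
   enumerations below affordable. *)
Fixpoint dist_gt (p q : positive) (d : nat) : bool :=
  match p with
  | xH => false
  | xO p' => match q with
    | xH => false
    | xO q' => dist_gt p' q' d
    | xI q' => if d is d'.+1 then dist_gt p' q' d' else true
    end
  | xI p' => match q with
    | xH => false
    | xI q' => dist_gt p' q' d
    | xO q' => if d is d'.+1 then dist_gt p' q' d' else true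
    end
  end.

Definition pos_of_bits (s : bitseq) : positive :=
  foldr (fun b p => if b then xI p else xO p) xH s.

Lemma pos_of_bitsK s : bits (pos_of_bits s) = s.
Proof. by elim: s => //= -[] s /= ->. Qed.

Lemma size_bits_xor p q : size (bits p) = size (bits q) ->
  size (bits (pos_xor p q)) = size (bits p).
Proof. by elim: p q => [p IHp|p IHp|] [q|q|] //= [/IHp->]. Qed.

Lemma nth_bits_xor p q i : size (bits p) = size (bits q) ->
  nth false (bits (pos_xor p q)) i = nth false (bits p) i (+) nth false (bits q) i.
Proof.
by elim: p q i => [p IHp|p IHp|] [q|q|] [|i] //= [/IHp].
Qed.

Lemma dist_gtE p q d : size (bits p) = size (bits q) ->
  dist_gt p q d = (d < count id (bits (pos_xor p q)))%N.
Proof.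
by elim: p q d => [p IHp|p IHp|] [q|q|] [|d] //= [/IHp IH]; rewrite ?IH ?add0n.
Qed.

Lemma pos_overlapE p q :
  pos_overlap p q = count (fun b => b.1 && b.2) (zip (bits p) (bits q)).
Proof. by elim: p q => [p IHp|p IHp|] [q|q|] //=; rewrite ?IHp. Qed.

Variable k : nat.

Definition bitvec (p : positive) : 'rV['F_2]_k := \row_j (nth false (bits p) j)%:R.

Lemma bitvec_neq0 p j : (bitvec p 0 j != 0) = nth false (bits p) j.
Proof. by rewrite mxE; case: nth. Qed.

Lemma count_nth (s : bitseq) : count id s = (\sum_(i < size s) nth false s i)%N.
Proof.
by elim: s => [|b s IHs]; rewrite ?big_ord0 // big_ord_recl /= IHs.
Qed.

Lemma wt_bitvec p : size (bits p) = k -> wt (bitvec p) = count id (bits p).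
Proof.
move=> pk; rewrite wtE count_nth pk; apply: eq_bigr => i _.
by rewrite bitvec_neq0.
Qed.

Lemma overlap_bitvec p q : size (bits p) = k -> size (bits q) = k ->
  overlap (bitvec p) (bitvec q) = pos_overlap p q.
Proof.
move=> pk qk; rewrite pos_overlapE overlapE.
have sz : size (zip (bits p) (bits q)) = k by rewrite size_zip pk qk minnn.
rewrite -[count _ _](count_map _ id) count_nth size_map sz; apply: eq_bigr => i _.
by rewrite !bitvec_neq0 (nth_map (false, false)) ?sz // nth_zip ?pk ?qk.
Qed.

Definition support (m : 'rV['F_2]_k) : bitseq := [seq m 0 i != 0 | i <- enum 'I_k].

Lemma size_support m : size (support m) = k.
Proof. by rewrite size_map size_enum_ord. Qed.

Lemma nth_support m (i : 'I_k) : nth false (support m) i = (m 0 i != 0).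
Proof. by rewrite (nth_map i) ?size_enum_ord // nth_ord_enum. Qed.

Lemma count_support m : count id (support m) = wt m.
Proof.
by rewrite count_nth size_support wtE; apply: eq_bigr => i _; rewrite nth_support.
Qed.

Lemma support_bitvec p : size (bits p) = k -> support (bitvec p) = bits p.
Proof.
move=> pk; apply: (@eq_from_nth _ false) => [|i]; rewrite size_support ?pk // => ik.
by rewrite (nth_support _ (Ordinal ik)) bitvec_neq0.
Qed.

Definition rows_mx (rows : seq positive) : 'M['F_2]_k :=
  \matrix_(i, j) bitvec (nth xH rows i) 0 j.

Lemma row_rows_mx rows i : row i (rows_mx rows) = bitvec (nth xH rows i).
Proof. by apply/rowP => j; rewrite !mxE. Qed.

Lemma mul_rows_mx rows m : size rows = k ->
  m *m rows_mx rows = \sum_(p <- mask (support m) rows) bitvec p.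
Proof.
move=> szr; rewrite mulmx_sum_row big_mask /= [RHS]big_mkcond /=.
under [RHS]eq_bigr => i _ do rewrite (tnth_nth xH) /= andbT.
rewrite szr; apply: eq_bigr => i _; rewrite nth_support row_rows_mx.
by case/orP: (F2P (m 0 i)) => /eqP ->; rewrite ?scale0r ?scale1r.
Qed.

Definition wf (p : positive) : bool := size (bits p) == k.

Lemma wf_xor p q : wf p -> wf q -> wf (pos_xor p q).
Proof. by rewrite /wf => /eqP pk /eqP qk; rewrite size_bits_xor pk ?qk. Qed.

Lemma bitvecD p q : wf p -> wf q -> bitvec (pos_xor p q) = bitvec p + bitvec q.
Proof.
move=> /eqP pk /eqP qk; apply/rowP => j; rewrite !mxE nth_bits_xor ?pk ?qk //.
by do 2![case: nth]; apply/eqP.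
Qed.

Definition pos_comb (r : positive) (m : bitseq) (rows : seq positive) : positive :=
  foldl pos_xor r (mask m rows).

Lemma pos_combP r m rows : wf r -> all wf rows ->
  wf (pos_comb r m rows) /\
  bitvec (pos_comb r m rows) = bitvec r + \sum_(p <- mask m rows) bitvec p.
Proof.
rewrite /pos_comb => wr /(all_mask m); elim: (mask m rows) r wr => /= [|p s IHs] r wr.
  by rewrite big_nil addr0.
by case/andP=> wp /IHs; rewrite big_cons addrA -bitvecD //; apply; apply: wf_xor.
Qed.

(* The threshold drops by one with each row used: that row contributes 1 to the
   weight of the codeword, in the other half of the coordinates. *)
Fixpoint span_gt (n t : nat) (r : positive) (rows : seq positive) : bool :=
  if n is n'.+1 then
    (fix scan l := if l is p :: l' then
        if dist_gt r p t then
          if span_gt n' t.-1 (pos_xor r p) l' then scan l' else false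
        else false
      else true) rows
  else true.

(** Induction on the number of rows still allowed, then on the list scanned. The first selected row
    either ends the sum, which [dist_gt] settles, or is absorbed into [r] before recursing. *)
Lemma span_gtP n t r rows m : wf r -> all wf rows -> span_gt n t r rows ->
  size m = size rows -> (0 < count id m <= n)%N ->
  (t.+1 < wt (bitvec r + \sum_(p <- mask m rows) bitvec p)%R + count id m)%N.
Proof.
elim: n t r rows m => [|n IHn] t r rows m wr; first by case: count.
elim: rows m => [|p l IHl] [|b m] //= /andP[wp wl].
case: ifP => // dp; case: ifP => // sp sl [szm].
case: b => /=; last by rewrite !add0n; apply: IHl.
rewrite add1n ltnS => mn; rewrite big_cons addrA -bitvecD //.
have wx := wf_xor wr wp.
have [m0|m_gt0] := posnP (count id m).
  have -> : mask m l = [::] by apply/size0nil; rewrite size_mask.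
  move: dp; rewrite big_nil addr0 m0 addn1 ltnS wt_bitvec; last exact/eqP.
  by rewrite dist_gtE // (eqP wr) (eqP wp).
(* At [t = 0] the predecessor is truncated, which only makes the test stricter. *)
have := IHn t.-1 _ l m wx wl sp szm; rewrite m_gt0 mn => /(_ isT).
by set a := wt _; set b := count _ _; lia.
Qed.

End BitVectors.

(** * Cyclic rotation of the coordinates in blocks of five *)

Section BlockRotation.

Fixpoint rot_blocks T (s : seq T) : seq T :=
  match s with
  | a :: b :: c :: d :: e :: s' => b :: c :: d :: e :: a :: rot_blocks s'
  | _ => s
  end.

(** The index permutation behind [rot_blocks]; indices after the last full block are fixed. *)
Definition block_succ n i := if (i < n %/ 5 * 5)%N then (i %/ 5 * 5 + i.+1 %% 5)%N else i.

Lemma nth_rot_blocks T (x : T) s i :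
  nth x (rot_blocks s) i = nth x s (block_succ (size s) i).
Proof.
have [n] := ubnP (size s); elim: n s i => // n IHn.
case=> [|a [|b [|c [|d [|e s]]]]] i //= sn; try by rewrite /block_succ.
case: i => [|[|[|[|[|i]]]]] /=; try by rewrite /block_succ ifT //; lia.
rewrite IHn; last by lia.
suff -> : block_succ (size s).+4.+1 i.+4.+1 = (block_succ (size s) i).+4.+1 by [].
rewrite /block_succ; set n' := size s.
have -> : (i.+4.+1 < n'.+4.+1 %/ 5 * 5)%N = (i < n' %/ 5 * 5)%N by lia.
by case: ifP => _ //; lia.
Qed.

Lemma size_rot_blocks T (s : seq T) : size (rot_blocks s) = size s.
Proof.
have [n] := ubnP (size s); elim: n s => // n IHn.
by case=> [|a [|b [|c [|d [|e s]]]]] //= sn; rewrite IHn //; lia.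
Qed.

Variable k : nat.

Lemma block_succ_ltn i : (i < k)%N -> (block_succ k i < k)%N.
Proof. by rewrite /block_succ; case: ifP; lia. Qed.

Definition ord_succ (i : 'I_k) : 'I_k := Ordinal (block_succ_ltn (ltn_ord i)).

Lemma ord_succ_inj : injective ord_succ.
Proof.
move=> i j /(congr1 val) /= ij; apply: val_inj => /=.
by move: ij; rewrite /block_succ; case: ifP => ?; case: ifP => ?; lia.
Qed.

Definition rotate n (M : 'M['F_2]_(n, k)) : 'M['F_2]_(n, k) :=
  \matrix_(i, j) M i (ord_succ j).

Lemma wt_rotate u : wt (rotate u) = wt u.
Proof.
rewrite !wtE [RHS](reindex_inj ord_succ_inj).
by apply: eq_bigr => i _; rewrite mxE.
Qed.

Variable A : 'M['F_2]_k.
Hypothesis rotA : forall i j, A (ord_succ i) (ord_succ j) = A i j.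

Lemma rotate_mulmx n (M : 'M_(n, k)) : rotate M *m A = rotate (M *m A).
Proof.
apply/matrixP => i j; rewrite !mxE [RHS](reindex_inj ord_succ_inj).
by apply: eq_bigr => l _; rewrite mxE rotA.
Qed.

Hypothesis k5 : (k %% 5 <= 1)%N.

(** Each rotation lowers the least index of the support by one within its block, and preserves both
    weights because it commutes with [A]. *)
Lemma rotate_to_block_start (m : 'rV_k) : m != 0 ->
  exists m', [/\ wt m' = wt m, wt (m' *m A) = wt (m *m A) &
    exists i : 'I_k, [/\ (5 %| i)%N, m' 0 i != 0 &
      forall j : 'I_k, (j < i)%N -> m' 0 j = 0]].
Proof.
move=> m_neq0; have /existsP[i0 mi0] : [exists i, m 0 i != 0].
  apply: contra_neqT m_neq0 => /existsPn m0; apply/rowP => i.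
  by rewrite mxE; apply/eqP/negPn.
case: (arg_minnP (P := fun i => m 0 i != 0) val mi0) => i mi /= min_i.
have {}min_i (j : 'I_k) : (j < i)%N -> m 0 j = 0.
  by move=> ji; apply/eqP; apply: contraTT ji => /min_i; rewrite -leqNgt.
clear i0 mi0 m_neq0; have [n] := ubnP i; elim: n m i mi min_i => // n IHn m i mi min_i ni.
have [i5|i5] := boolP (5 %| i)%N; first by exists m; split=> //; exists i.
(* By [k5] at most one index lies outside the full blocks, and it is a multiple of 5; so [i] and its
   predecessor share a full block. *)
have ik := ltn_ord i; have i1k : (i.-1 < k)%N by lia.
have succ_i1 : ord_succ (Ordinal i1k) = i.
  by apply: val_inj; rewrite /= /block_succ; case: ifP; lia.
have [|||m' [wm' wm'A m'P]] := IHn (rotate m) (Ordinal i1k); last first.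
- exists m'; split=> //; first by rewrite wm' wt_rotate.
  by rewrite wm'A rotate_mulmx wt_rotate.
- by rewrite /=; lia.
- move=> j /= ji; rewrite mxE; apply: min_i; rewrite /= /block_succ; case: ifP; lia.
- by rewrite mxE succ_i1.
Qed.

End BlockRotation.

(** * Enumeration of short sums of rows *)

Section Enumeration.
Variable k : nat.

(* Up to a block rotation the least row occurring in a sum is the first one of
   its block, so only these rows are tried as least rows. *)
Definition orbits_gt (n t : nat) (rows : seq positive) : bool :=
  all (fun b => if drop (5 * b) rows is p :: l then
         if (t < count id (bits p))%N then span_gt n t.-1 p l else false
       else true) (iota 0 (k %/ 5).+1).

Lemma orbits_gtP n t rows (m : 'rV['F_2]_k) (i : 'I_k) :
    size rows = k -> all (wf k) rows -> orbits_gt n t rows ->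
    (5 %| i)%N -> m 0 i != 0 -> (forall j : 'I_k, (j < i)%N -> m 0 j = 0) ->
  (wt m <= n.+1)%N -> (t.+1 < wt m + wt (m *m rows_mx k rows))%N.
Proof.
move=> szr wfr /allP og i5 mi m0; rewrite mul_rows_mx // -count_support => mn.
have ik := ltn_ord i.
have /og : (i %/ 5)%N \in iota 0 (k %/ 5).+1 by rewrite mem_iota; lia.
have -> : (5 * (i %/ 5) = i)%N by lia.
rewrite (drop_nth xH) ?szr //; set p := nth _ _ _; set l := drop _ _.
case: ifP => // tp sp.
have szt : size (take i (support m)) = i by rewrite size_takel // size_support ltnW.
(* Row [p] is thus the least row of the sum, and all others come from [l]. *)
have supp_m : support m = nseq i false ++ true :: drop i.+1 (support m).
  rewrite -{1}(cat_take_drop i (support m)) (drop_nth false) ?size_support //.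
  rewrite nth_support mi; congr (_ ++ _).
  apply: (@eq_from_nth _ false) => [|j]; rewrite szt ?size_nseq // => ji.
  have jk := ltn_trans ji ik; rewrite nth_take // nth_nseq ji.
  by rewrite (nth_support m (Ordinal jk)) m0 // eqxx.
have wp : wf k p by apply: (all_nthP xH wfr); rewrite szr.
have wl : all (wf k) l 
  by move: wfr; rewrite -{1}(cat_take_drop i.+1 rows) all_cat => /andP[].
have -> : \sum_(q <- mask (support m) rows) bitvec k q =
          bitvec k p + \sum_(q <- mask (drop i.+1 (support m)) l) bitvec k q.
  rewrite [X in mask X rows]supp_m -(cat_take_drop i rows) mask_cat; last first.
    by rewrite size_nseq size_takel // szr ltnW.
  by rewrite mask_false cat0s (drop_nth xH) ?szr // -/l -/p big_cons.
have -> : count id (support m) = (count id (drop i.+1 (support m))).+1.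
  by rewrite {1}supp_m count_cat count_nseq mul0n /= add1n.
move: mn; rewrite {1}supp_m count_cat count_nseq mul0n add0n /= add1n ltnS => mn.
have szl : size (drop i.+1 (support m)) = size l.
  by rewrite !size_drop size_support szr.
have [c0|c_gt0] := posnP (count id (drop i.+1 (support m))).
  have -> : mask (drop i.+1 (support m)) l = [::] by apply/size0nil; rewrite size_mask.
  by rewrite big_nil addr0 c0 wt_bitvec ?(eqP wp) // add1n ltnS.
have := span_gtP wp wl sp szl; rewrite c_gt0 => /(_ mn).
set a := wt _; set b := count _ _; lia.
Qed.

(** The first conjunct handles the empty sum, which [span_gt] does not test. *)
Definition coset_gt (n t : nat) (r : positive) (rows : seq positive) : bool :=
  (t.+1 < count id (bits r))%N && span_gt n t r rows.

Lemma coset_gtP n t r rows (m : 'rV['F_2]_k) :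
    wf k r -> size rows = k -> all (wf k) rows -> coset_gt n t r rows ->
  (wt m <= n)%N -> (t.+1 < wt m + wt (bitvec k r + m *m rows_mx k rows))%N.
Proof.
move=> wr szr wfr /andP[tr sp]; rewrite mul_rows_mx // -count_support addnC => mn.
have [c0|c_gt0] := posnP (count id (support m)); last first.
  by apply: (span_gtP wr wfr sp); rewrite ?size_support ?szr ?c_gt0.
have -> : mask (support m) rows = [::].
  by apply/size0nil; rewrite size_mask // size_support.
by rewrite big_nil addr0 c0 addn0 wt_bitvec //; exact/eqP.
Qed.

Lemma rows_mx_rot rows : size rows = k -> all (wf k) rows ->
    [seq rot_blocks (bits p) | p <- rot_blocks rows] = map bits rows ->
  forall i j : 'I_k,
    rows_mx k rows (ord_succ i) (ord_succ j) = rows_mx k rows i j.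
Proof.
move=> szr wfr rot i j; rewrite !mxE; congr _%:R; congr nat_of_bool.
have row_i : rot_blocks (bits (nth xH rows (block_succ k i))) = bits (nth xH rows i).
  have : nth [::] (map bits rows) i = bits (nth xH rows i) by rewrite (nth_map xH) ?szr.
  by rewrite -rot (nth_map xH) ?size_rot_blocks ?szr // nth_rot_blocks szr.
rewrite -row_i nth_rot_blocks (eqP (all_nthP xH wfr _ _)) // szr.
exact: block_succ_ltn.
Qed.

Definition transpose (rows : seq positive) : seq positive :=
  let ss := map bits rows in
  [seq pos_of_bits [seq nth false s j | s <- ss] | j <- iota 0 k].

Lemma size_transpose rows : size (transpose rows) = k.
Proof. by rewrite size_map size_iota. Qed.

Lemma wf_transpose rows : size rows = k -> all (wf k) (transpose rows).
Proof.
move=> szr; rewrite all_map; apply/allP => j _ /=.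
by rewrite /wf pos_of_bitsK !size_map szr.
Qed.

Lemma rows_mx_transpose rows : size rows = k ->
  rows_mx k (transpose rows) = (rows_mx k rows)^T.
Proof.
move=> szr; apply/matrixP => i j; rewrite !mxE (nth_map 0) ?size_iota //.
by rewrite nth_iota // pos_of_bitsK -map_comp (nth_map xH) ?szr.
Qed.

Definition orthonormal (rows : seq positive) : bool :=
  all (fun p => odd (pos_overlap p p)) rows &&
  pairwise (fun p q => ~~ odd (pos_overlap p q)) rows.

Lemma orthonormalP rows : size rows = k -> all (wf k) rows -> orthonormal rows ->
  rows_mx k rows *m (rows_mx k rows)^T = 1%:M.
Proof.
move=> szr wfr /andP[/(all_nthP xH) on_diag /(pairwiseP xH) off_diag].
have wf_i (i : 'I_k) : size (bits (nth xH rows i)) = k.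
  by apply/eqP/(all_nthP xH wfr); rewrite szr.
apply/matrixP => i j; rewrite [RHS]mxE.
have -> : (rows_mx k rows *m (rows_mx k rows)^T) i j =
    dotp (bitvec k (nth xH rows i)) (bitvec k (nth xH rows j)).
  by rewrite mxE; apply: eq_bigr => l _; rewrite !mxE.
have szi (l : 'I_k) : val l \in gtn (size rows) by rewrite -topredE /= szr ltn_ord.
case: (ltngtP i j) => [ij|ij|/val_inj->]; last first.
- by rewrite eqxx; apply/eqP; rewrite dotp_eq1 overlap_bitvec // on_diag ?szr.
- rewrite -val_eqE gtn_eqF //; apply/eqP; rewrite dotp_eq0.
  by rewrite overlapC overlap_bitvec // (off_diag _ _ (szi j) (szi i) ij).
rewrite -val_eqE ltn_eqF //; apply/eqP; rewrite dotp_eq0.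
by rewrite overlap_bitvec // (off_diag _ _ (szi i) (szi j) ij).
Qed.

End Enumeration.

(** * Boolean certificates and their soundness *)

Section Certificate.
Variable k : nat.

Definition zero_pos : positive := iter k xO xH.

(** This is [char_form] on the rows of [I | A]: the unit vector in the left half adds 1 to the
    weight and a digit of [v1] to the overlap. *)
Definition char_rows (rows : seq positive) (v1 v2 : positive) : bool :=
  all (fun i => let p := nth xH rows i in
    4 %| (count id (bits p)).+1 + (nth false (bits v1) i + pos_overlap p v2).*2)%N
  (iota 0 k).

Definition self_dual_check (rows : seq positive) : bool :=
  [&& size rows == k, all (wf k) rows, orthonormal rows &
      [seq rot_blocks (bits p) | p <- rot_blocks rows] == map bits rows].

(* A word of weight at most 12 has at most 6 ones in its left half or at most 5
   in its right half; [orbits_gt k n t] treats the sums of at most [n.+1] rows. *)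
Definition min_weight_check (rows : seq positive) (m : positive) : bool :=
  [&& wf k m,
      (count id (bits m) +
        count id (bits (pos_comb zero_pos (bits m) rows)) == 14)%N,
      orbits_gt k 5 11 rows & orbits_gt k 4 11 (transpose k rows)].

(* All weights in the shadow are congruent to [s] modulo 4, so it suffices to
   exclude weights up to [s - 4], i.e. at most [(s - 4)./2] ones in some half. *)
Definition shadow_check (rows : seq positive) (v1 v2 : positive) (s : nat) : bool :=
  [&& wf k v1, wf k v2, char_rows rows v1 v2,
      (count id (bits v1) + count id (bits v2) == s)%N &
      ((s < 4) ||
        coset_gt (s - 4)./2 (s - 5) (pos_comb v2 (bits v1) rows) rows &&
        (let cols := transpose k rows in
         coset_gt (s - 4)./2 (s - 5) (pos_comb v1 (bits v2) cols) cols))%N].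

Lemma wf_zero : wf k zero_pos.
Proof. by rewrite /wf /zero_pos; elim: k => //= n /eqP ->. Qed.

Lemma bitvec_zero : bitvec k zero_pos = 0.
Proof.
apply/rowP => j; rewrite !mxE /zero_pos.
suff -> : nth false (bits (iter k xO xH)) j = false by [].
by elim: {j}k (j : nat) => [|n IHn] [|j] //=.
Qed.

Variable rows : seq positive.
Hypothesis check_rows : self_dual_check rows.
Let A := rows_mx k rows.

Lemma check_size : size rows = k.
Proof. by case/and4P: check_rows => /eqP. Qed.

Lemma check_wf : all (wf k) rows.
Proof. by case/and4P: check_rows. Qed.

Lemma check_orthonormal : A *m A^T = 1%:M.
Proof.
by apply: orthonormalP; [exact: check_size | exact: check_wf | case/and4P: check_rows].
Qed.

Lemma check_rot (i j : 'I_k) : A (ord_succ i) (ord_succ j) = A i j.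
Proof.
apply: rows_mx_rot; [exact: check_size | exact: check_wf |].
by case/and4P: check_rows => _ _ _ /eqP.
Qed.

Lemma check_transpose : rows_mx k (transpose k rows) = A^T.
Proof. exact: rows_mx_transpose check_size. Qed.

Lemma wt_encode m : wt (encode A m) = (wt m + wt (m *m A))%N.
Proof. by rewrite encodeE wt_row_mx. Qed.

Lemma pos_comb_bits r m rs : wf k r -> wf k m -> size rs = k -> all (wf k) rs ->
  wf k (pos_comb r (bits m) rs) /\
  bitvec k (pos_comb r (bits m) rs) = bitvec k r + bitvec k m *m rows_mx k rs.
Proof.
move=> wr /eqP wm szr wfr; have [? ->] := pos_combP (bits m) wr wfr.
by split=> //; rewrite mul_rows_mx // support_bitvec.
Qed.

Lemma min_weight_checkP m : (k %% 5 <= 1)%N -> min_weight_check rows m ->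
  singly_even (code A) /\ code_params (code A) k 14.
Proof.
move=> k5 /and4P[wm /eqP m14 or oc].
have [wc mA] := pos_comb_bits wf_zero wm check_size check_wf.
have wt14 : wt (encode A (bitvec k m)) = 14.
  rewrite wt_encode -[_ *m _]add0r -bitvec_zero -mA.
  by rewrite !wt_bitvec ?(eqP wm) ?(eqP wc).
have memC : encode A (bitvec k m) \in code A by apply/codeP; exists (bitvec k m).
(* Since 14 is 2 modulo 4, the word of minimum weight also shows that the code is singly even. *)
split; first by exists (encode A (bitvec k m)) => //; rewrite wt14.
split; first exact: dim_code.
split.
  exists (encode A (bitvec k m)) => //; rewrite !inE memC andbT.
  apply/eqP => e0; move: wt14; rewrite e0.
  by rewrite /wt (_ : finset _ = set0) ?cards0 //; apply/setP => i; rewrite !inE mxE eqxx.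
move=> u; rewrite !inE => /andP[u0 uC].
suff : (12 < wt u)%N by have := even_wt_code check_orthonormal uC; lia.
case/codeP: uC u0 => l -> {u} l0.
have {l0} l_neq0 : l != 0 by apply: contraNneq l0 => ->; rewrite /encode mul0mx.
rewrite wt_encode.
have [l6|l6] := leqP (wt l) 6.
  have [l' [wl wlA [i [i5 l'i l'0]]]] := rotate_to_block_start check_rot k5 l_neq0.
  rewrite -wl -wlA.
  by apply: (orbits_gtP check_size check_wf or i5 l'i l'0); rewrite wl.
(* Otherwise the total weight is at least 7 + 6 = 13. *)
have [r5|r5] := leqP (wt (l *m A)) 5; last by lia.
(* The same codeword is now read as the sum of rows of [A^T | I] selected by its right half. *)
have lE : l = l *m A *m A^T by rewrite -mulmxA check_orthonormal mulmx1.
have r_neq0 : l *m A != 0 by apply: contraNneq l_neq0 => e; rewrite lE e mul0mx.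
have rot_t (i j : 'I_k) : A^T (ord_succ i) (ord_succ j) = A^T i j.
  by rewrite mxE [RHS]mxE check_rot.
have [r' [wr wrA [i [i5 r'i r'0]]]] := rotate_to_block_start rot_t k5 r_neq0.
have wft := wf_transpose check_size.
have := orbits_gtP (size_transpose k rows) wft oc i5 r'i r'0.
by rewrite check_transpose wrA -lE wr addnC; apply.
Qed.

Lemma shadow_checkP v1 v2 s : singly_even (code A) ->
  shadow_check rows v1 v2 s -> has_min_weight (shadow (code A)) s.
Proof.
move=> se /and5P[w1 w2 /allP ch /eqP wv cosets].
pose v := row_mx (bitvec k v1) (bitvec k v2).
have char_v i : char_form v (encode A (delta_mx 0 i)).
  have := ch i; rewrite mem_iota ltn_ord => /(_ isT).
  rewrite /char_form encodeE wt_row_mx overlap_row_mx wt_delta overlap_delta.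
  rewrite -rowE row_rows_mx bitvec_neq0.
  have wi : wf k (nth xH rows i) by apply: (all_nthP xH check_wf); rewrite check_size.
  by rewrite overlap_bitvec ?wt_bitvec ?(eqP wi) ?(eqP w2).
have memS := mem_shadow check_orthonormal char_v se.
have wt_v : wt v = s by rewrite wt_row_mx !wt_bitvec ?(eqP w1) ?(eqP w2).
split; first by exists v => //; rewrite memS addF2_mx mem0v.
move=> u uS; have := wt_shadow check_orthonormal char_v se uS; rewrite wt_v => us4.
(* For [s < 4], [s] is itself the residue of the weight modulo 4, hence a lower bound. *)
case/orP: cosets => [s4|/andP[cr cc]]; first by move: us4; lia.
rewrite leqNgt; apply/negP => us.
have {us us4} us : (wt u <= s - 4)%N /\ (4 <= s)%N by move: us4; lia.
(* Since [v + u] is a codeword, each half of [u] determines the other by an affine map; the half of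
   smaller weight is the one to enumerate. *)
have [ulr lr] : (wt (lsubmx u) + wt (rsubmx u) <= s - 4)%N /\
    bitvec k v2 + rsubmx u = (bitvec k v1 + lsubmx u) *m A.
  move: us uS; rewrite memS mem_code -[u]hsubmxK /v add_row_mx !row_mxKl !row_mxKr.
  by rewrite wt_row_mx => -[us _] /eqP.
move: (lsubmx u) (rsubmx u) ulr lr => l r ulr lr.
have [lh|lh] := leqP (wt l) (s - 4)./2.
  have [wc cE] := pos_comb_bits w2 w1 check_size check_wf.
  have := coset_gtP wc check_size check_wf cr lh.
  have -> : bitvec k (pos_comb v2 (bits v1) rows) + l *m rows_mx k rows = r.
    by rewrite cE -addrA -mulmxDl -lr addrA addF2_mx add0r.
  lia.
have rh : (wt r <= (s - 4)./2)%N by lia.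
have wft := wf_transpose check_size.
have szt := size_transpose k rows.
have [wc cE] := pos_comb_bits w1 w2 szt wft.
have := coset_gtP wc szt wft cc rh.
have -> : bitvec k (pos_comb v1 (bits v2) (transpose k rows)) +
    r *m rows_mx k (transpose k rows) = l.
  rewrite cE check_transpose -addrA -mulmxDl lr -mulmxA check_orthonormal mulmx1.
  by rewrite addrA addF2_mx add0r.
lia.
Qed.

End Certificate.

(** * The four explicit codes *)

Section BlockCirculantCodes.

Definition rot_pos (p : positive) : positive := pos_of_bits (rot_blocks (bits p)).

(* The matrix is an 8-by-8 array of 5-by-5 circulants with a border of one row
   and one column; [gens] lists the last row of each band, then the border row. *)
Definition band_rows (gens : seq positive) : seq positive :=
  flatten [seq rev (traject rot_pos p 5) | p <- take 8 gens] ++ drop 8 gens.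

Lemma certified_code s (gens : seq positive) (m v1 v2 : positive) :
    self_dual_check 41 (band_rows gens) ->
    min_weight_check 41 (band_rows gens) m ->
    shadow_check 41 (band_rows gens) v1 v2 s ->
  exists C : {vspace 'rV['F_2]_82},
    [/\ self_dual C, singly_even C, code_params C 41 14
      & has_min_weight (shadow C) s].
Proof.
have k5 : (41 %% 5 <= 1)%N by [].
move=> sd /(min_weight_checkP sd k5)[se d14] /(shadow_checkP sd se) sh.
have sdC := self_dual_code (check_orthonormal sd).
(* The lengths [41 + 41] and [82] agree by conversion. *)
exact: (ex_intro _ (code (rows_mx 41 (band_rows gens))) (And4 sdC se d14 sh)).
Qed.

(* These generators come from a computer search. For [gens1] it produced a doubly
   even [80,40,16] code D and an odd vector t at distance 13 from D: splitting D
   as D0 + D1 by orthogonality to t, the code of length 82 consists of (00, D0),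
   (11, D1), (10, t + D0) and (01, t + D1), and has a coordinate vector in its
   shadow. The others were reached by repeatedly passing to neighbours. *)
Definition gens1 : seq positive := [:: 4208192971977; 3842832033059; 3095260879763;
  2291320713843; 4173171678523; 2694877796502;
  2673211019983; 3079384750573; 2200096965631]%positive.

Definition gens5 : seq positive := [:: 2290481308250; 3275584766354; 2932216153700;
  3206339386829; 3307559686648; 2858016494299;
  4195693481267; 4200694369017; 3265247838208]%positive.

Definition gens9 : seq positive := [:: 2600516928781; 2390787906754; 3213110612764;
  3217395831417; 3169060909123; 3674303398917;
  3617491843049; 3618483922647; 3265216379935]%positive.

Definition gens13 : seq positive := [:: 4001416177609; 4212134541398; 2597798369748;
  3819594551707; 3920484502638; 2981384735936;
  3166630791002; 3233812389324; 4398046479328]%positive.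

Lemma self_dual_gens1 : self_dual_check 41 (band_rows gens1).
Proof. by vm_compute. Qed.

(** The number encodes the left half of a codeword of weight 14; likewise for the other codes. *)
Lemma min_weight_gens1 : min_weight_check 41 (band_rows gens1) 3573446344704.
Proof. by vm_compute. Qed.

(** The halves are 2^41 + 2^40 and 2^41, that is, the coordinate vector of the last position of the
    left half. *)
Lemma shadow_gens1 : shadow_check 41 (band_rows gens1) 3298534883328
  2199023255552 1.
Proof. by vm_compute. Qed.

Lemma self_dual_gens5 : self_dual_check 41 (band_rows gens5).
Proof. by vm_compute. Qed.

Lemma min_weight_gens5 : min_weight_check 41 (band_rows gens5) 2199023779855.
Proof. by vm_compute. Qed.

(** The halves are 2^41 and 2^41 + 31: zero on the left, and on the right the ones of the first
    block. *)
Lemma shadow_gens5 : shadow_check 41 (band_rows gens5) 2199023255552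
  2199023255583 5.
Proof. by vm_compute. Qed.

Lemma self_dual_gens9 : self_dual_check 41 (band_rows gens9).
Proof. by vm_compute. Qed.

Lemma min_weight_gens9 : min_weight_check 41 (band_rows gens9) 2336730644739.
Proof. by vm_compute. Qed.

Lemma shadow_gens9 : shadow_check 41 (band_rows gens9) 2267776811648
  2211908161568 9.
Proof. by vm_compute. Qed.

Lemma self_dual_gens13 : self_dual_check 41 (band_rows gens13).
Proof. by vm_compute. Qed.

Lemma min_weight_gens13 : min_weight_check 41 (band_rows gens13) 2336495765507.
Proof. by vm_compute. Qed.

Lemma shadow_gens13 : shadow_check 41 (band_rows gens13) 2200113774625
  2491091666436 13.
Proof. by vm_compute. Qed.

End BlockCirculantCodes.

Theorem proposition8 (s : nat) (hs : s \in [:: 1%N; 5%N; 9%N; 13%N]) :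
  exists C : {vspace 'rV['F_2]_82},
    [/\ self_dual C, singly_even C, code_params C 41 14
      & has_min_weight (shadow C) s].
Proof.
move: hs; rewrite !inE => /or4P[] /eqP ->.
- exact: (certified_code self_dual_gens1 min_weight_gens1 shadow_gens1).
- exact: (certified_code self_dual_gens5 min_weight_gens5 shadow_gens5).
- exact: (certified_code self_dual_gens9 min_weight_gens9 shadow_gens9).
- exact: (certified_code self_dual_gens13 min_weight_gens13 shadow_gens13).
Qed.
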